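(* Let $N\ge 1$ be an integer, let $Q_N$ and $P_N$ be the $(N+1)\times(N+1)$ position and momentum matrices, let $x_0,\dots,x_N$ be the $N+1$ distinct eigenvalues of $Q_N$, and let $U_N=[u_0^{(N)},\dots,u_N^{(N)}]$ be the modal matrix of $Q_N$, whose $j$-th column is an eigenvector for $x_j$. Then the momentum matrix in the position representation, $P_N^{(q)}:=U_N^\dagger P_N U_N$, has entries $$P^{(q)}_{N;\,j,k}=\frac{i}{x_k-x_j}\quad\text{for } j\neq k,\qquad P^{(q)}_{N;\,j,j}=0\quad\text{for all } j=0,\dots,N.$$
   Context: Rows and columns are indexed by $0,1,\dots,N$. The position matrix $Q_N$ is the real symmetric tridiagonal matrix with $(Q_N)_{k,k+1}=(Q_N)_{k+1,k}=\sqrt{k+1}/\sqrt{2}$ for $k=0,\dots,N-1$ and all other entries $0$. The momentum matrix $P_N$ is the Hermitian tridiagonal matrix with $(P_N)_{k,k+1}=-i\sqrt{k+1}/\sqrt{2}$ and $(P_N)_{k+1,k}=i\sqrt{k+1}/\sqrt{2}$ for $k=0,\dots,N-1$ and all other entries $0$. The modal matrix $U_N$ has as its $j$-th column the real eigenvector $u_j^{(N)}$ of $Q_N$ for $x_j$, normalized to Euclidean norm $1$ and with its sign chosen so that its last component (index $N$) is nonnegative. $\dagger$ denotes the conjugate transpose. *)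

(* Defs.v *)
From HB Require Import structures.
From mathcomp Require Import all_boot all_order all_algebra.
From mathcomp Require Import complex reals.

Set Implicit Arguments.
Unset Strict Implicit.
Unset Printing Implicit Defensive.

Import Order.TTheory GRing.Theory Num.Theory.
Local Open Scope ring_scope.
Local Open Scope sesquilinear_scope.

Definition position_mx (R : realType) (N : nat) : 'M[R]_N.+1 :=
  \matrix_(k, l)
    if (l == k.+1 :> nat) then Num.sqrt k.+1%:R / Num.sqrt 2
    else if (k == l.+1 :> nat) then Num.sqrt l.+1%:R / Num.sqrt 2
    else 0.

Definition momentum_mx (R : realType) (N : nat) : 'M[R[i]]_N.+1 :=
  \matrix_(k, l)
    if (l == k.+1 :> nat) then - 'i%C * (Num.sqrt k.+1%:R / Num.sqrt 2)%:C%C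
    else if (k == l.+1 :> nat) then 'i%C * (Num.sqrt l.+1%:R / Num.sqrt 2)%:C%C
    else 0.

(* The eigenvectors are columns, whereas the library predicate [eigenvalue] is
   stated with row vectors; for the symmetric [position_mx] the eigenvalues are
   the same. The norm on matrices in the library is the sup norm, hence the
   explicit Euclidean norm. *)
Definition modal_mx (R : realType) (N : nat) (Q : 'M[R]_N.+1)
    (x : 'I_N.+1 -> R) (U : 'M[R]_N.+1) : Prop :=
  forall j : 'I_N.+1,
    [/\ Q *m col j U = x j *: col j U,
        Num.sqrt (\sum_(k < N.+1) U k j ^+ 2) = 1
      & 0 <= U ord_max j].

Definition momentum_position_mx (R : realType) (N : nat) (U : 'M[R]_N.+1) :
    'M[R[i]]_N.+1 :=
  let V := map_mx (real_complex R) U in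
  V ^t* *m momentum_mx R N *m V.

(* Main.v *)
(** Writing [D] for the truncated annihilation operator divided by [sqrt 2], one has
    [Q = D + D^T], [P = i A] with [A = D^T - D] real antisymmetric, and
    [[Q, A] = 2 (D D^T - D^T D) = 1 - (N+1) e_N e_N^T]: the truncation shows up only in
    the last diagonal entry. Conjugating by the orthogonal matrix [U] and putting
    [B = U^T A U] gives [(x_j - x_k) B_jk = delta_jk - (N+1) U_Nj U_Nk]. The diagonal of
    this identity forces [U_Nj = 1 / sqrt (N+1)], so the off-diagonal entries read
    [(x_j - x_k) B_jk = -1]; the diagonal of [B] vanishes by antisymmetry. *)

Require Import Defs.
From HB Require Import structures.
From mathcomp Require Import all_boot all_order all_algebra.
From mathcomp Require Import ring.
From mathcomp Require Import complex reals.

Set Implicit Arguments.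
Unset Strict Implicit.
Unset Printing Implicit Defensive.

Import Order.TTheory GRing.Theory Num.Theory.
Local Open Scope ring_scope.

Definition lowering_mx (R : realType) (N : nat) : 'M[R]_N.+1 :=
  \matrix_(k, l) if l == k.+1 :> nat then Num.sqrt k.+1%:R / Num.sqrt 2 else 0.

Lemma position_mxE (R : realType) (N : nat) :
  position_mx R N = lowering_mx R N + (lowering_mx R N)^T.
Proof.
apply/matrixP => k l; rewrite !mxE.
case: eqP => [->|_]; last by rewrite add0r.
by rewrite ltn_eqF ?addr0 // leqW.
Qed.

Definition real_momentum_mx (R : realType) (N : nat) : 'M[R]_N.+1 :=
  (lowering_mx R N)^T - lowering_mx R N.

Lemma momentum_mxE (R : realType) (N : nat) :
  momentum_mx R N = 'i%C *: map_mx (real_complex R) (real_momentum_mx R N).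
Proof.
apply/matrixP => k l; rewrite !mxE.
case: eqP => [->|_].
  by rewrite ltn_eqF ?ltnS ?leqnSn //= add0r rmorphN mulrN mulNr.
by case: eqP => _; rewrite subr0 // rmorph0 mulr0.
Qed.

Lemma tr_real_momentum_mx (R : realType) (N : nat) :
  (real_momentum_mx R N)^T = - real_momentum_mx R N.
Proof. by rewrite /real_momentum_mx linearB /= trmxK opprB. Qed.

Lemma sqr_lowering_coef (R : realType) (n : nat) :
  (Num.sqrt n%:R / Num.sqrt 2) * (Num.sqrt n%:R / Num.sqrt 2) = n%:R / 2 :> R.
Proof. by rewrite -expr2 expr_div_n !sqr_sqrtr ?ler0n. Qed.

(** The only nonzero entry of row [k] of [lowering_mx] sits in column [k + 1]. For [k = N] that
    column is cut off, hence the exception at [ord_max]. *)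
Lemma lowering_raising_mx (R : realType) (N : nat) :
  lowering_mx R N *m (lowering_mx R N)^T =
  \matrix_(k, l) ((k.+1%:R / 2) *+ ((k == l) && (k != ord_max))).
Proof.
apply/matrixP => k l; rewrite !mxE.
have [->|kN] /= := eqVneq k ord_max.
  rewrite andbF mulr0n big1 // => m _; rewrite !mxE.
  by rewrite ltn_eqF ?mul0r.
have ltk : (k.+1 < N.+1)%N.
  by rewrite ltnS ltn_neqAle kN -ltnS ltn_ord.
rewrite (bigD1 (Ordinal ltk)) //= !mxE eqxx big1 ?addr0.
  rewrite andbT eqSS -(inj_eq val_inj).
  by case: eqP => [<-|_]; rewrite ?mulr0 // sqr_lowering_coef.
move=> m mk; rewrite !mxE ifN ?mul0r //.
Qed.

Lemma raising_lowering_mx (R : realType) (N : nat) :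
  (lowering_mx R N)^T *m lowering_mx R N =
  \matrix_(k, l) ((k%:R / 2) *+ (k == l)).
Proof.
apply/matrixP => k l; rewrite !mxE.
(* The sum is supported at [m = k - 1]. For [k = 0] it is empty, in agreement with the value
   [0 / 2], so here the truncation leaves no exception. *)
case: (posnP k) => [k0|k_gt0].
  by rewrite k0 mul0r mul0rn big1 // => m _; rewrite !mxE k0 mul0r.
have ltk : (k.-1 < N.+1)%N by rewrite (leq_ltn_trans (leq_pred k)).
rewrite (bigD1 (Ordinal ltk)) //= !mxE /= prednK // eqxx big1 ?addr0.
  rewrite -(inj_eq val_inj) eq_sym.
  by case: eqP => _; rewrite ?mulr0 // sqr_lowering_coef.
move=> m mk; rewrite !mxE ifN ?mul0r //.
by apply: contraNN mk => /eqP km; apply/eqP/val_inj; rewrite /= km.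
Qed.

Lemma truncated_commutation (R : realType) (N : nat) :
  position_mx R N *m real_momentum_mx R N - real_momentum_mx R N *m position_mx R N
  = 1%:M - N.+1%:R *: delta_mx ord_max ord_max.
Proof.
have -> : position_mx R N *m real_momentum_mx R N -
          real_momentum_mx R N *m position_mx R N =
  (lowering_mx R N *m (lowering_mx R N)^T - (lowering_mx R N)^T *m lowering_mx R N)
  *+ 2.
  rewrite position_mxE /real_momentum_mx.
  move: (lowering_mx R N) => D.
  rewrite !(mulmxDl, mulmxDr, mulNmx, mulmxN) !opprD !opprK mulr2n.
  move: (D *m D) (D *m D^T) (D^T *m D) (D^T *m D^T) => a b c d.
  by apply/matrixP => i j; rewrite !mxE; ring.
rewrite lowering_raising_mx raising_lowering_mx.
apply/matrixP => k l; rewrite !mxE.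
rewrite mulr2n.
have [<-|kl] := eqVneq k l; last first.
  have -> : (k == ord_max) && (l == ord_max) = false.
    by apply: contraNF kl => /andP[/eqP-> /eqP->].
  by rewrite !(mulr0n, mulr0, subr0, addr0).
(* The diagonal entry is [(k + 1) - k = 1] for [k < N], but [0 - N = 1 - (N + 1)] for [k = N]. *)
have [->|kN] := eqVneq k ord_max; rewrite /= ?mulr0n ?mulr1n -?natr1 /=; by field.
Qed.

Lemma tr_position_mx (R : realType) (N : nat) :
  (position_mx R N)^T = position_mx R N.
Proof. by rewrite position_mxE linearD /= trmxK addrC. Qed.

Section Modal.
Variables (R : realType) (N : nat) (Q : 'M[R]_N.+1).
Variables (x : 'I_N.+1 -> R) (U : 'M[R]_N.+1).
Hypotheses (symQ : Q^T = Q) (x_inj : injective x) (hU : modal_mx Q x U).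

Let X := diag_mx (\row_j x j).

Lemma modal_mx_eigen : Q *m U = U *m X.
Proof.
apply/matrixP => k j; have [/matrixP/(_ k 0) e _ _] := hU j.
rewrite mul_mx_diag; move: e; rewrite !mxE mulrC => <-.
by apply: eq_bigr => m _; rewrite !mxE.
Qed.

Lemma modal_mx_eigen_tr : U^T *m Q = X *m U^T.
Proof. by rewrite -{1}symQ -trmx_mul modal_mx_eigen trmx_mul tr_diag_mx. Qed.

(** [Q] turns into [X] when moved past [U] on the right or past [U^T] on the left. Orthogonality of
    [U] is not assumed, so the identity can serve to prove it. *)
Lemma modal_mx_commutator (A : 'M[R]_N.+1) j k :
  (U^T *m (Q *m A - A *m Q) *m U) j k = (x j - x k) * (U^T *m A *m U) j k.
Proof.
rewrite mulmxBr mulmxBl !mulmxA modal_mx_eigen_tr -!mulmxA modal_mx_eigen.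
rewrite !mulmxA -!(mulmxA X) mul_diag_mx mul_mx_diag.
by rewrite mxE [in RHS]mulrBl !mxE [in RHS](mulrC (x k)).
Qed.

Lemma modal_mx_orthogonal : U^T *m U = 1%:M.
Proof.
apply/matrixP => j k; rewrite [RHS]mxE.
have [<-|jk] := eqVneq j k.
  have [_ n1 _] := hU j; rewrite mxE -[RHS](expr1n _ 2) -n1 sqr_sqrtr.
    by apply: eq_bigr => m _; rewrite mxE expr2.
  by apply: sumr_ge0 => m _; rewrite sqr_ge0.
(* The identity matrix commutes with [Q], so [(x j - x k) * (U^T *m U) j k = 0], and the first
   factor is nonzero. *)
have := modal_mx_commutator 1%:M j k.
rewrite mulmx1 mul1mx subrr mulmx0 mul0mx mxE mulmx1 => /esym/eqP.
by rewrite mulf_eq0 subr_eq0 (inj_eq x_inj) (negbTE jk) => /eqP.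
Qed.

End Modal.

Section RealMomentum.
Variables (R : realType) (N : nat) (x : 'I_N.+1 -> R) (U : 'M[R]_N.+1).
Hypotheses (x_inj : injective x) (hU : modal_mx (position_mx R N) x U).

Let B := U^T *m real_momentum_mx R N *m U.

Lemma real_momentum_position_commutator j k :
  (x j - x k) * B j k = (j == k)%:R - N.+1%:R * (U ord_max j * U ord_max k).
Proof.
rewrite -(modal_mx_commutator (tr_position_mx R N) hU) truncated_commutation.
rewrite mulmxBr mulmxBl mulmx1 (modal_mx_orthogonal (tr_position_mx R N) x_inj hU).
(* Splitting the rank-one [delta_mx] into a column times a row makes its conjugate the outer product
   of the last row of [U] with itself. *)
rewrite -scalemxAr -scalemxAl -(mul_delta_mx (0 : 'I_1)) (mulmxA U^T) -(mulmxA (U^T *m _)).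
by rewrite -colE -rowE !mxE big_ord1 !mxE.
Qed.

Lemma modal_mx_last j : U ord_max j = (Num.sqrt N.+1%:R)^-1.
Proof.
have [_ _ U_ge0] := hU j.
have /esym/eqP := real_momentum_position_commutator j j.
rewrite subrr mul0r eqxx subr_eq0 -expr2 => /eqP e.
(* The diagonal identity fixes only the square of [U ord_max j]; the sign convention on the last
   component selects the nonnegative root. *)
apply: (pexpIrn (n := 2)) => //; rewrite ?nnegrE ?invr_ge0 ?sqrtr_ge0 //.
rewrite exprVn sqr_sqrtr ?ler0n //; apply: (mulfI (x := N.+1%:R)).
  by rewrite pnatr_eq0.
by rewrite -e divff // pnatr_eq0.
Qed.

Lemma real_momentum_position_diag j : B j j = 0.
Proof.
have trB : B^T = - B.
  by rewrite /B !trmx_mul trmxK tr_real_momentum_mx mulNmx mulmxN mulmxA.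
by move/matrixP/(_ j j): trB; rewrite mxE [RHS]mxE => /eqP; rewrite -addr_eq0 -mulr2n mulrn_eq0 => /eqP.
Qed.

Lemma real_momentum_position_offdiag j k : j != k -> B j k = (x k - x j)^-1.
Proof.
move=> jk; have := real_momentum_position_commutator j k.
rewrite (negbTE jk) !modal_mx_last -expr2 exprVn sqr_sqrtr ?ler0n //.
rewrite divff ?pnatr_eq0 // sub0r => e.
have kj : x k - x j != 0 by rewrite subr_eq0 (inj_eq x_inj) eq_sym.
by apply: (mulfI kj); rewrite divff // -opprB mulNr e opprK.
Qed.

End RealMomentum.

(** As [U] is real, its conjugate transpose is its transpose, and the factor [i] comes out of the
    product; what remains is a computation over [R]. *)
Lemma momentum_position_mxE (R : realType) (N : nat) (U : 'M[R]_N.+1) :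
  momentum_position_mx U =
  'i%C *: map_mx (real_complex R) (U^T *m real_momentum_mx R N *m U).
Proof.
rewrite /momentum_position_mx momentum_mxE !map_mxM -scalemxAr -scalemxAl.
congr (_ *: (_ *m _ *m _)).
by apply/matrixP => k l; rewrite !mxE; exact: conjc_real.
Qed.

Theorem mainTheorem5 (R : realType) (N : nat) (hN : (1 <= N)%N)
    (x : 'I_N.+1 -> R) (x_inj : injective x)
    (x_eig : forall j : 'I_N.+1, eigenvalue (position_mx R N) (x j))
    (U : 'M[R]_N.+1) (hU : modal_mx (position_mx R N) x U) :
  (forall j k : 'I_N.+1, j != k ->
     momentum_position_mx U j k = 'i%C / (x k - x j)%:C%C) /\
  (forall j : 'I_N.+1, momentum_position_mx U j j = 0).
Proof.
rewrite momentum_position_mxE; split=> [j k jk|j]; rewrite 2!mxE.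
  by rewrite (real_momentum_position_offdiag x_inj hU) // fmorphV.
by rewrite real_momentum_position_diag rmorph0 mulr0.
Qed.
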